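(* Let $n\ge3$, $s\in(0,1)$, $K>0$, and let $u\in C(\mathbb{R}^n)\cap L^1_{\omega_s}(\mathbb{R}^n)$. Assume that $u$ is semiconcave with a modulus, in the sense that $$u(x+y)+u(x-y)-2u(x)\le m(|y|)\qquad\text{for all }x,y\in\mathbb{R}^n,$$ for some modulus of continuity $m:[0,\infty)\to[0,\infty)$ with $$2(1-s)\int_0^\infty\frac{m(r)}{r^{1+2s}}\,dr\le K.$$ Then, for $x\in\mathbb{R}^n$ and for all $y,z\in\mathbb{R}^n$ such that $\mathcal{I}^su(x,y+z)$, $\mathcal{I}^su(x,y-z)$ and $\mathcal{I}^su(x,y)$ are finite, $$\mathcal{I}^s u(x,y+z)+\mathcal{I}^s u(x,y-z)-2\,\mathcal{I}^s u(x,y)\le 2K|z|^{2s}.$$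
   Context: $L^1_{\omega_s}(\mathbb{R}^n)$ is the set of $u$ with $\int_{\mathbb{R}^n}\frac{|u(y)|}{1+|y|^{n+2s}}\,dy<\infty$. With $\delta u(x,y)=u(x+y)+u(x-y)-2u(x)$, $$\mathcal{I}^su(x,y)=(1-s)\int_{-\infty}^\infty\frac{\delta u(x,ry)}{|r|^{1+2s}}\,dr.$$ A modulus of continuity is a nondecreasing continuous function $m:[0,\infty)\to[0,\infty)$ with $m(0)=0$. *)

(* Defs.v *)
From HB Require Import structures.
From mathcomp Require Import all_boot all_order all_algebra.
From mathcomp Require Import all_classical all_reals all_analysis.

Set Implicit Arguments.
Unset Strict Implicit.
Unset Printing Implicit Defensive.

Import Order.TTheory GRing.Theory Num.Theory.
Import numFieldTopology.Exports numFieldNormedType.Exports.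

Local Open Scope classical_set_scope.
Local Open Scope ring_scope.

(* MathComp-Analysis has Lebesgue measure on R only; on R^n it is built here by
   iterating the binary product: R^0 carries the Dirac mass, and R^(n+1) the
   image of the product measure on R * R^n under (a, t) |-> a :: t. *)
Section lebesgue_measure_succ.
Context {R : realType} (n : nat).
Variable mu : {sigma_finite_measure set (n.-tuple (measurableTypeR R)) -> \bar R}.

Definition tuple_cons (p : measurableTypeR R * n.-tuple (measurableTypeR R)) :
  n.+1.-tuple (measurableTypeR R) := [tuple of p.1 :: p.2].

Lemma measurable_tuple_cons : measurable_fun [set: _] tuple_cons.
Proof. by apply: measurable_cons; [exact: measurable_fst|exact: measurable_snd]. Qed.

Definition lebesgue_succ : set (n.+1.-tuple (measurableTypeR R)) -> \bar R :=
  pushforward (@lebesgue_measure R \x mu)%E tuple_cons.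

Let ls0 : lebesgue_succ set0 = 0%E.
Proof. by rewrite /lebesgue_succ /pushforward preimage_set0 measure0. Qed.

Let ls_ge0 A : (0 <= lebesgue_succ A)%E.
Proof. by rewrite /lebesgue_succ /pushforward measure_ge0. Qed.

Let ls_sigma_additive : semi_sigma_additive lebesgue_succ.
Proof.
move=> F mF tF mUF; rewrite /lebesgue_succ /pushforward preimage_bigcup.
have mp A : measurable A -> measurable (tuple_cons @^-1` A).
  by move=> mA; rewrite -[X in measurable X]setTI; exact: measurable_tuple_cons.
apply: measure_semi_sigma_additive.
- by move=> k; exact: mp.
- apply/trivIsetP => /= i j _ _ ij; rewrite -preimage_setI.
  by move/trivIsetP : tF => /(_ _ _ _ _ ij) ->//; rewrite preimage_set0.
- by rewrite -preimage_bigcup; exact: mp.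
Qed.

HB.instance Definition _ := isMeasure.Build _ _ _ lebesgue_succ
  ls0 ls_ge0 ls_sigma_additive.

Let ls_sigma_finite : sigma_finite setT lebesgue_succ.
Proof.
have /sigma_finiteP[F [TF ndF Foo]] := sigma_finiteT (@lebesgue_measure R).
have /sigma_finiteP[G [TG ndG Goo]] := sigma_finiteT mu.
pose g (t : n.+1.-tuple (measurableTypeR R)) := (thead t, [tuple of behead t]).
have mg : measurable_fun setT g.
  apply/measurable_fun_pairP; split; first exact: measurable_tnth.
  exact: measurable_behead.
have gK p : g (tuple_cons p) = p.
  by case: p => a t; congr (_, _); apply: val_inj.
exists (fun k => g @^-1` (F k `*` G k)).
  apply/esym/seteqP; split => // t _.
  have : setT (thead t) by [].
  have : setT [tuple of behead t] by [].
  rewrite TF TG => -[j _ Gj] [i _ Fi]; exists (maxn i j) => //; split.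
  - by move: Fi; apply/subsetPset/ndF/leq_maxl.
  - by move: Gj; apply/subsetPset/ndG/leq_maxr.
move=> k; have [mF Foo'] := Foo k; have [mG Goo'] := Goo k; split.
  by rewrite -[X in measurable X]setTI; apply: mg => //; exact: measurableX.
rewrite /lebesgue_succ /pushforward -comp_preimage.
rewrite (_ : g \o tuple_cons = id); last exact/funext.
by rewrite preimage_id product_measure1E// lte_mul_pinfty// ge0_fin_numE.
Qed.

HB.instance Definition _ := Measure_isSigmaFinite.Build _ _ _ lebesgue_succ
  ls_sigma_finite.

End lebesgue_measure_succ.

Fixpoint lebesgue_tuple (R : realType) (n : nat) :
    {sigma_finite_measure set (n.-tuple (measurableTypeR R)) -> \bar R} :=
  if n is k.+1 then lebesgue_succ (lebesgue_tuple R k)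
  else \d_([tuple] : 0.-tuple (measurableTypeR R)).

Lemma lebesgue_tuple_box (R : realType) (n : nat)
    (A : 'I_n -> set (measurableTypeR R)) : (forall i, measurable (A i)) ->
  lebesgue_tuple R n [set t | forall i, A i (tnth t i)] =
  (\prod_(i < n) lebesgue_measure (A i))%E.
Proof.
elim: n A => [|n IH] A mA.
  rewrite big_ord0 /= diracE mem_set//= => -[].
  by [].
rewrite big_ord_recl -IH; last by move=> i; exact: mA.
rewrite /= /lebesgue_succ /pushforward -product_measure1E//; last first.
  rewrite (_ : mkset _ = \bigcap_(i : 'I_n) ((tnth (T:=measurableTypeR R))^~ i @^-1` (A (lift ord0 i)))); last first.
    by apply/seteqP; split => t /= h i; [move=> _|]; apply: h.
  apply: fin_bigcap_measurable => //= i _.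
  by rewrite -[X in measurable X]setTI; apply: measurable_tnth.
congr (product_measure1 _ _ _); apply/seteqP; split => -[a t] /=.
  move=> h; split; first exact: (h ord0).
  by move=> i; have := h (lift ord0 i); rewrite tnthS.
move=> [ha ht] i; case: (unliftP ord0 i) => [j|] ->; last exact: ha.
by rewrite tnthS.
Qed.

Section definitions.
Context {R : realType} {n : nat}.
Implicit Types (u : 'rV[R]_n -> R) (x y : 'rV[R]_n) (s : R) (m : R -> R).

(* The library norm on 'rV[R]_n is the sup norm, hence this definition. *)
Definition enorm x : R := Num.sqrt (\sum_i x 0 i ^+ 2).

Definition row_of_tuple (t : n.-tuple (measurableTypeR R)) : 'rV[R]_n :=
  \row_i tnth t i.

Definition L1_omega s u : Prop :=
  measurable_fun [set: n.-tuple (measurableTypeR R)] (u \o row_of_tuple) /\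
  (\int[lebesgue_tuple R n]_t
     (`|u (row_of_tuple t)| /
      (1 + enorm (row_of_tuple t) `^ (n%:R + 2 * s)))%:E < +oo)%E.

Definition delta2 u x y : R := u (x + y) + u (x - y) - 2 * u x.

(* The library sets +oo - +oo = -oo, so that, for s < 1 and a measurable
   integrand, this value is a finite number exactly when the integrand is
   Lebesgue integrable. The integrand takes the
   value 0 at r = 0, which is a null set. *)
Definition dir_frac_lap s u x y : \bar R :=
  ((1 - s)%:E * \int[@lebesgue_measure R]_r
     (delta2 u x (r *: y) / `|r| `^ (1 + 2 * s))%:E)%E.

(* Functions on [0, +oo[ are represented by total functions on R whose values
   at negative reals are irrelevant. *)
Definition modulus_of_continuity m : Prop :=
  [/\ forall r, 0 <= r -> 0 <= m r,
      forall r1 r2, 0 <= r1 -> r1 <= r2 -> m r1 <= m r2,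
      {within `[0, +oo[, continuous m} &
      m 0 = 0].

End definitions.

(* Main.v *)
Require Import Defs.
From mathcomp Require Import all_boot all_order all_algebra.
From mathcomp Require Import all_classical all_reals all_analysis.
From mathcomp Require Import measurable_realfun ring lra.

Import Order.TTheory GRing.Theory Num.Theory.
Import numFieldTopology.Exports numFieldNormedType.Exports.

Local Open Scope classical_set_scope.
Local Open Scope ring_scope.

(** For a fixed [r], the second difference in [y], with step [z], of
    [delta2 u x (r y)] is the sum of the second differences of [u] with step
    [r z] at the two points [x + r y] and [x - r y]. Semiconcavity therefore
    bounds it by [2 m(|r| |z|)] ([second_difference_delta2]).

    Finiteness of the three directional operators means that their integrands
    are integrable ([dir_frac_lap_integrable]), so the left-hand side is
    [1 - s] times a single integral, which is at most
    [(1 - s) \int 2 m(|r| |z|) / |r|^(1 + 2 s) dr]. Folding the line at [0] and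
    substituting [r |z|] for [r] ([integral_modulus_dilation]) turns this bound
    into [4 (1 - s) |z|^(2 s) \int_0^oo m(r) / r^(1 + 2 s) dr], that is,
    [2 |z|^(2 s)] times the quantity assumed to be at most [K]. *)

(** The Lebesgue measure is [c] times its image under the dilation [r |-> c r]
    (compare both on intervals), so the integral may be taken against that
    image and pulled back. Arguing on measures rather than on antiderivatives
    accommodates integrands such as [m r / r^(1 + p)], singular at [0]. *)
Lemma ge0_integral_dilation {R : realType} {c : R} {f : R -> \bar R} :
  0 < c -> measurable_fun setT f -> (forall r, 0 <= f r)%E ->
  (\int[@lebesgue_measure R]_(r in `]0%R, +oo[) f r =
   c%:E * \int[@lebesgue_measure R]_(r in `]0%R, +oo[) f (c * r)%R)%E.
Proof.
move=> c0 mf f0.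
have mc : measurable_fun setT ( *%R c : _ -> measurableTypeR R).
  exact: mulrl_measurable.
have c_ge0 := ltW c0.
(* The measure structure on an image measure depends on the measurability of
   the map, abstracted by the first definition and supplied by the second. *)
pose nu_of : {measure set (measurableTypeR R) -> \bar R} :=
  mscale (NngNum c_ge0)
    (pushforward (@lebesgue_measure R) ( *%R c : _ -> measurableTypeR R)).
pose nu := nu_of mc.
transitivity (\int[nu]_(r in `]0%R, +oo[) f r)%E.
  apply: eq_measure_integral => A mA _; move: A mA.
  apply: lebesgue_measure_unique => //= _ [[a b]] _ <-.
  rewrite /nu /mscale /= /pushforward.
  rewrite (_ : _ @^-1` _ = `]a / c, b / c]%classic); last first.
    apply/seteqP; split => r /=;
      by rewrite !in_itv/= ltr_pdivrMr// ler_pdivlMr// mulrC.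
  rewrite !lebesgue_measure_itv/= !lte_fin ltr_pM2r ?invr_gt0//.
  case: ifPn => _; last by rewrite mule0.
  by rewrite -!EFinB -EFinM -mulrBl mulrC divfK// gt_eqF.
rewrite ge0_integral_mscale//=; last exact: measurable_funTS.
rewrite ge0_integral_pushforward//; last exact: measurable_funTS.
congr (_ * _)%E; congr integral.
by apply/seteqP; split => r /=; rewrite !in_itv/= !andbT pmulr_rgt0.
Qed.

Lemma ge0_integral_even {R : realType} {f : R -> \bar R} :
  measurable_fun setT f -> (forall r, 0 <= f r)%E -> (forall r, f (- r) = f r) ->
  (\int[@lebesgue_measure R]_r f r =
   2%:E * \int[@lebesgue_measure R]_(r in `]0%R, +oo[) f r)%E.
Proof.
move=> mf f0 fN.
have mfS A : measurable_fun A f by exact: measurable_funTS.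
rewrite (_ : setT = `]-oo, 0%R] `|` `]0%R, +oo[)%classic; last first.
  apply/esym/seteqP; split => // r _ /=; rewrite !in_itv/= andbT.
  by case: leP; [left|right].
rewrite ge0_integral_setU//=; [|exact: mfS|]; last first.
  apply/disj_setPS => r /= []; rewrite !in_itv/= andbT => /le_lt_trans /[apply].
  by rewrite ltxx.
rewrite mule_natl mule2n; congr (_ + _)%E.
transitivity (\int[@lebesgue_measure R]_(r in `[0%R, +oo[) f r)%E; last first.
  by rewrite -integral_itv_obnd_cbnd.
rewrite ge0_integration_by_substitution0//.
by apply: eq_integral => r _; rewrite fN.
Qed.

(** The integral of [f] is the difference of the integrals of [f^+] and [f^-],
    and in [\bar R] a difference is finite only when both terms are. *)
Lemma fin_num_integrable d (T : measurableType d) (R : realType)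
    (mu : {measure set T -> \bar R}) (D : set T) (f : T -> \bar R) :
  measurable D -> measurable_fun D f ->
  (\int[mu]_(t in D) f t)%E \is a fin_num -> mu.-integrable D f.
Proof.
move=> mD mf; rewrite integralE fin_numB => /andP[fp fn].
apply/integrableP; split=> //.
under eq_integral => t _ do rewrite -[`|f t|%E]/((abse \o f) t) fune_abse.
rewrite ge0_integralD//; last 2 first.
- exact: measurable_funepos.
- exact: measurable_funeneg.
by rewrite lte_add_pinfty// ltey_eq ?fp ?fn.
Qed.

(** The chain [\int f <= \int f^+ <= \int g] makes sense in [\bar R] even when
    the integral of [g] is infinite. *)
Lemma le_integral_majorant d (T : measurableType d) (R : realType)
    (mu : {measure set T -> \bar R}) (D : set T) (f g : T -> \bar R) :
  measurable D -> measurable_fun D f -> measurable_fun D g ->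
  (forall t, D t -> 0 <= g t)%E -> (forall t, D t -> f t <= g t)%E ->
  (\int[mu]_(t in D) f t <= \int[mu]_(t in D) g t)%E.
Proof.
move=> mD mf mg g0 fg; rewrite integralE.
apply: (@le_trans _ _ (\int[mu]_(t in D) f^\+ t)%E).
  by rewrite geeDl// leeNl oppe0; exact: integral_ge0.
apply: ge0_le_integral => //; first exact: measurable_funepos.
by move=> t Dt; rewrite funeposE ge_max fg//= g0.
Qed.

Lemma enormZ (R : realType) (n : nat) (r : R) (z : 'rV[R]_n) :
  enorm (r *: z) = `|r| * enorm z.
Proof.
rewrite /enorm (_ : \sum_i _ = r ^+ 2 * \sum_i z 0 i ^+ 2); last first.
  by rewrite mulr_sumr; apply: eq_bigr => i _; rewrite mxE exprMn.
by rewrite sqrtrM ?sqr_ge0// sqrtr_sqr.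
Qed.

Lemma continuous_delta2_ray (R : realType) (n : nat) (u : 'rV[R]_n -> R)
    (x y : 'rV[R]_n) :
  continuous u -> continuous (fun r : R => delta2 u x (r *: y)).
Proof.
move=> cu r; rewrite /delta2.
have cl : {for r, continuous (fun r : R => r *: y)} by exact: scalel_continuous.
have cD : {for r, continuous (fun r : R => x + r *: y)}.
  by apply: cvgD => //; exact: cvg_cst.
have cB : {for r, continuous (fun r : R => x - r *: y)}.
  by apply: cvgB => //; exact: cvg_cst.
apply: cvgB; last exact: cvg_cst.
apply: cvgD.
- exact: (continuous_comp cD (cu _)).
- exact: (continuous_comp cB (cu _)).
Qed.

Lemma measurable_weight (R : realType) (p : R) :
  measurable_fun [set: R] (fun r : R => (`|r| `^ p)^-1).
Proof.
rewrite (_ : (fun r => _) = (@powR R)^~ (- p) \o (fun r : R => `|r|)); last first.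
  by apply/funext => r /=; rewrite powRN.
exact: measurableT_comp.
Qed.

(** The pointwise heart of the proof: the second difference of
    [y |-> delta2 u x y] in the direction [z] is the sum of the second
    differences of [u] in the direction [z] at [x + y] and at [x - y], as the
    terms in [u x] cancel. *)
Lemma second_difference_delta2 (R : realType) (n : nat) (u : 'rV[R]_n -> R)
    (m : R -> R) (x y z : 'rV[R]_n) :
  (forall x y : 'rV[R]_n, u (x + y) + u (x - y) - 2 * u x <= m (enorm y)) ->
  delta2 u x (y + z) + delta2 u x (y - z) - 2 * delta2 u x y <= 2 * m (enorm z).
Proof.
move=> hum; rewrite /delta2.
have := lerD (hum (x + y) z) (hum (x - y) z).
rewrite !opprD !opprK !addrA.
rewrite (addrAC x (- y) (- z)) (addrAC x (- y) z); lra.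
Qed.

(** A modulus is constrained on nonnegative arguments only; precomposing it with
    [Num.max 0] gives a function nondecreasing on the whole line. *)
Lemma measurable_modulus_max0 {R : realType} {m : R -> R} :
  modulus_of_continuity m -> measurable_fun setT (fun r : R => m (Num.max 0 r)).
Proof.
move=> [_ m_nd _ _]; apply: nondecreasing_measurable => // r1 r2 r12.
by apply: m_nd; [rewrite le_max lexx|rewrite ge_max !le_max lexx r12 orbT].
Qed.

Lemma measurable_modulus_norm {R : realType} {c : R} {m : R -> R} :
  0 <= c -> modulus_of_continuity m ->
  measurable_fun setT (fun r : R => m (`|r| * c)).
Proof.
move=> c0 hm.
rewrite (_ : (fun r => _) =
  (m \o Num.max 0) \o (fun r : R => `|r| * c)); last first.
  by apply/funext => r /=; rewrite max_r// mulr_ge0.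
apply: measurableT_comp; first exact: measurable_modulus_max0.
by apply: measurable_funM => //; exact: normr_measurable.
Qed.

(** Evenness contributes a factor [2], the dilation [r |-> c r] a factor
    [c ^ (1 + p) / c]; for [c = 0] both sides vanish because [m 0 = 0]. *)
Lemma integral_modulus_dilation {R : realType} {p c : R} {m : R -> R} :
  0 <= c -> modulus_of_continuity m -> 0 < p ->
  (\int[@lebesgue_measure R]_r (2 * m (`|r| * c) / `|r| `^ (1 + p))%:E =
   (4 * c `^ p)%:E * \int[@lebesgue_measure R]_(r in `]0%R, +oo[)
     (m r / r `^ (1 + p))%:E)%E.
Proof.
move=> c_ge0 hm p0; have [m_ge0 m_nd _ m0] := hm.
have [->|/eqP c_neq0] := eqVneq c 0.
  rewrite powR0 ?gt_eqF// mulr0 mul0e.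
  by rewrite integral0_eq// => r _; rewrite mulr0 m0 mulr0 mul0r.
have c0 : 0 < c by rewrite lt0r c_ge0 andbT; exact/eqP.
pose f (r : R) : R := m (Num.max 0 r) * (`|r| `^ (1 + p))^-1.
have f0 (r : R) : 0 <= f r.
  by rewrite mulr_ge0 ?invr_ge0 ?powR_ge0// m_ge0// le_max lexx.
have mM := measurable_modulus_max0 hm.
have mf : measurable_fun setT f.
  by apply: measurable_funM => //; exact: measurable_weight.
have fE (r : R) : 0 < r -> f r = m r / r `^ (1 + p).
  by move=> r0; rewrite /f max_r ?gtr0_norm ?ltW.
(* The factor [(`|r| `^ (1 + p))^-1], common to both sides, is kept opaque, so
   that the identity also covers [r = 0]. *)
have f'E (r : R) : 2 * m (`|r| * c) / `|r| `^ (1 + p) =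
    2 * c `^ (1 + p) * f (c * `|r|).
  rewrite /f max_r ?mulr_ge0// normrM normr_id (gtr0_norm c0) powRM//.
  rewrite [c * _]mulrC invfM.
  have : c `^ (1 + p) != 0 by rewrite gt_eqF// powR_gt0.
  by move: (c `^ (1 + p)) ((`|r| `^ (1 + p))^-1) => w v w0; field.
under eq_integral do rewrite f'E.
rewrite ge0_integral_even; last 3 first.
- apply/measurable_EFinP; apply: measurable_funM => //.
  by apply: measurableT_comp => //; exact: measurable_funM.
- by move=> r; rewrite lee_fin mulr_ge0// mulr_ge0// powR_ge0.
- by move=> r; rewrite normrN.
under eq_integral.
  move=> r; rewrite inE/= in_itv/= andbT => r0; rewrite gtr0_norm// EFinM.
  over.
have mfc : measurable_fun (`]0%R, +oo[%classic : set R)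
    (fun r : R => (f (c * r))%:E).
  apply: measurable_funTS; apply/measurable_EFinP.
  exact: (measurableT_comp mf (mulrl_measurable c)).
rewrite ge0_integralZl//=; last 2 first.
- by move=> r _; rewrite lee_fin.
- by rewrite lee_fin mulr_ge0// powR_ge0.
transitivity ((4 * c `^ p)%:E * \int[@lebesgue_measure R]_(r in `]0%R, +oo[)
    (f r)%:E)%E; last first.
  congr (_ * _)%E; apply: eq_integral => r.
  by rewrite inE/= in_itv/= andbT => r0; rewrite fE.
rewrite (@ge0_integral_dilation _ c (EFin \o f))//=; last first.
  exact/measurable_EFinP.
rewrite !muleA -!EFinM; congr (_%:E * _)%E.
rewrite powRD; last by rewrite (gt_eqF c0) implybT.
by rewrite powRr1//; ring.
Qed.

(** Since [1 - s] is nonzero, finiteness of the product defining the operator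
    passes to the integral. *)
Lemma dir_frac_lap_integrable {R : realType} {n : nat} {s : R}
    {u : 'rV[R]_n -> R} {x y : 'rV[R]_n} :
  s < 1 -> continuous u -> dir_frac_lap s u x y \is a fin_num ->
  (@lebesgue_measure R).-integrable setT
    (fun r => (delta2 u x (r *: y) / `|r| `^ (1 + 2 * s))%:E).
Proof.
move=> s1 cu fin; apply: fin_num_integrable => //.
  apply/measurable_EFinP; apply: measurable_funM; last exact: measurable_weight.
  by apply: continuous_measurable_fun; exact: continuous_delta2_ray.
have s1' : 1 - s != 0 by rewrite subr_eq0 gt_eqF.
move: fin; rewrite /dir_frac_lap.
set I := (X in (_ * X)%E) => fin.
suff : I \is a fin_num by [].
have -> : I = ((1 - s)^-1%:E * ((1 - s)%:E * I))%E.
  by rewrite muleA -EFinM mulVf// mul1e.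
by rewrite fin_numM.
Qed.

Theorem lemma2p7 (R : realType) (n : nat) (s K : R) (u : 'rV[R]_n -> R)
    (m : R -> R)
    (hn : (3 <= n)%N) (hs0 : 0 < s) (hs1 : s < 1) (hK : 0 < K)
    (hu_cont : continuous u) (hu_L1 : L1_omega s u)
    (hm : modulus_of_continuity m)
    (hum : forall x y : 'rV[R]_n, u (x + y) + u (x - y) - 2 * u x <= m (enorm y))
    (hmK : ((2 * (1 - s))%:E *
             \int[@lebesgue_measure R]_(r in `]0%R, +oo[)
               (m r / r `^ (1 + 2 * s))%:E <= K%:E)%E)
    (x y z : 'rV[R]_n)
    (hyz : dir_frac_lap s u x (y + z) \is a fin_num)
    (hyz' : dir_frac_lap s u x (y - z) \is a fin_num)
    (hy : dir_frac_lap s u x y \is a fin_num) :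
  (dir_frac_lap s u x (y + z) + dir_frac_lap s u x (y - z)
     - 2%:E * dir_frac_lap s u x y
   <= (2 * K * enorm z `^ (2 * s))%:E)%E.
Proof.
have s0' : 0 < 1 - s by rewrite subr_gt0.
have i1 := dir_frac_lap_integrable hs1 hu_cont hyz.
have i2 := dir_frac_lap_integrable hs1 hu_cont hyz'.
have i3 := dir_frac_lap_integrable hs1 hu_cont hy.
pose D v (r : R) := (delta2 u x (r *: v) / `|r| `^ (1 + 2 * s))%:E.
pose S (r : R) := (D (y + z)%R r + D (y - z)%R r - 2%:E * D y r)%E.
have i12 := integrableD measurableT i1 i2.
have i3' := integrableZl measurableT 2 i3.
have iS := integrableB measurableT i12 i3'.
have -> : (dir_frac_lap s u x (y + z) + dir_frac_lap s u x (y - z)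
    - 2%:E * dir_frac_lap s u x y =
    (1 - s)%:E * \int[@lebesgue_measure R]_r S r)%E.
  have -> : (\int[@lebesgue_measure R]_r S r =
      \int[@lebesgue_measure R]_r D (y + z)%R r +
      \int[@lebesgue_measure R]_r D (y - z)%R r -
      2%:E * \int[@lebesgue_measure R]_r D y r)%E.
    rewrite [LHS](integralB measurableT i12 i3').
    by rewrite (integralD measurableT i1 i2) (integralZl measurableT i3).
  have lapE v : dir_frac_lap s u x v =
      ((1 - s)%:E * \int[@lebesgue_measure R]_r D v r)%E by [].
  have f1 : (\int[@lebesgue_measure R]_r D (y + z)%R r)%E \is a fin_num.
    exact: (integrable_fin_num measurableT i1).
  have f2 : (\int[@lebesgue_measure R]_r D (y - z)%R r)%E \is a fin_num.
    exact: (integrable_fin_num measurableT i2).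
  have f3 : (\int[@lebesgue_measure R]_r D y r)%E \is a fin_num.
    exact: (integrable_fin_num measurableT i3).
  have distr (a b c : \bar R) : a \is a fin_num -> b \is a fin_num ->
      c \is a fin_num -> ((1 - s)%:E * a + (1 - s)%:E * b -
      2%:E * ((1 - s)%:E * c) = (1 - s)%:E * (a + b - 2%:E * c))%E.
    move: a b c => [a| |] [b| |] [c| |]//= _ _ _.
    by congr EFin; ring.
  by rewrite !lapE distr.
pose g (r : R) := (2 * m (`|r| * enorm z) / `|r| `^ (1 + 2 * s))%:E.
have z0 : 0 <= enorm z by exact: sqrtr_ge0.
have hm0 : forall r, 0 <= r -> 0 <= m r by case: hm.
have le_Sg :
    (\int[@lebesgue_measure R]_r S r <= \int[@lebesgue_measure R]_r g r)%E.
  apply: le_integral_majorant => //.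
  - exact: (measurable_int _ iS).
  - apply/measurable_EFinP; apply: measurable_funM; last exact: measurable_weight.
    by apply: measurable_funM => //; exact: measurable_modulus_norm.
  - move=> r _; rewrite lee_fin mulr_ge0 ?invr_ge0 ?powR_ge0// mulr_ge0// hm0//.
    by rewrite mulr_ge0.
  - move=> r _; rewrite /S /D /g -EFinM -!EFinD lee_fin.
    rewrite mulrA -mulrDl -mulrBl ler_wpM2r ?invr_ge0 ?powR_ge0// -enormZ.
    rewrite scalerDr scalerBr.
    exact: second_difference_delta2.
apply: (@le_trans _ _ ((1 - s)%:E * \int[@lebesgue_measure R]_r g r)%E).
  by rewrite lee_pmul2l// lte_fin.
rewrite integral_modulus_dilation//; last by rewrite mulr_gt0.
rewrite muleA -EFinM.
rewrite (_ : (1 - s) * _ = (2 * enorm z `^ (2 * s)) * (2 * (1 - s)));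
  last by ring.
rewrite EFinM -muleA (_ : 2 * K * _ = (2 * enorm z `^ (2 * s)) * K);
  last by ring.
by rewrite [leRHS]EFinM lee_wpmul2l// lee_fin mulr_ge0// powR_ge0.
Qed.
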